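(* Let $K$ be a field and let $X$ be a connected poset such that every multiplicative automorphism of $FI(X,K)$ is inner and every derivation from $FI(X,K)$ to $I(X,K)$ is inner (in particular, this covers the case when $X$ has an element that is comparable with all its elements). If $\phi$ is an automorphism of the $K$-algebra $D(X,K)$, then $\phi=\Psi\circ\widetilde{\alpha}\circ\widetilde{k\delta}$, where $\Psi$ is an inner automorphism of $D(X,K)$, $\alpha$ is an automorphism of $X$ and $k\in K^*$.
   Context: For a field $K$ and a poset $X$, the incidence space $I(X,K)$ is the $K$-space of functions $f:X\times X\to K$ with $f(x,y)=0$ whenever $x\nleq y$. The finitary incidence algebra $FI(X,K)$ is the subspace of all $f\in I(X,K)$ such that for all $x\le y$ in $X$ there are only finitely many subintervals $[u,v]\subseteq[x,y]$ with $u\ne v$ and $f(u,v)\neq 0$. It is an associative unital $K$-algebra, with unity $\delta$, under convolution $(fg)(x,y)=\sum_{x\le z\le y}f(x,z)g(z,y)$, and the same formula makes $I(X,K)$ an $FI(X,K)$-bimodule. $D(X,K)$ is the $K$-algebra $FI(X,K)\oplus I(X,K)$, elements written as columns, with multiplication $\begin{bmatrix}f\\ i\end{bmatrix}\begin{bmatrix}g\\ j\end{bmatrix}=\begin{bmatrix}fg\\ fj+ig\end{bmatrix}$. Automorphisms of algebras are $K$-linear; inner automorphisms are the maps $a\mapsto uau^{-1}$, $u$ a unit. A poset is connected if any two elements are joined by a finite sequence in which consecutive elements are comparable. An automorphism of a poset is a bijection $\alpha$ with $x\le y\Leftrightarrow\alpha(x)\le\alpha(y)$. A multiplicative automorphism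 of $FI(X,K)$ is a map $M_\sigma(f)(x,y)=\sigma(x,y)f(x,y)$, where $\sigma\in I(X,K)$ satisfies $\sigma(x,y)\neq0$ for all $x\le y$ and $\sigma(x,y)\sigma(y,z)=\sigma(x,z)$ for $x\le y\le z$. A derivation $D:FI(X,K)\to I(X,K)$ is a $K$-linear map with $D(fg)=D(f)g+fD(g)$; it is inner if there is $i\in I(X,K)$ with $D(f)=fi-if$ for all $f$. For an automorphism $\alpha$ of $X$, $\widetilde\alpha\left(\begin{bmatrix}f\\ i\end{bmatrix}\right)=\begin{bmatrix}f'\\ i'\end{bmatrix}$ with $f'(x,y)=f(\alpha^{-1}(x),\alpha^{-1}(y))$ and $i'(x,y)=i(\alpha^{-1}(x),\alpha^{-1}(y))$. For $k\in K^*$, $\widetilde{k\delta}\left(\begin{bmatrix}f\\ i\end{bmatrix}\right)=\begin{bmatrix}f\\ ki\end{bmatrix}$. *)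

(* Defs.v *)
From HB Require Import structures.
From mathcomp Require Import all_boot all_order all_algebra.
From mathcomp Require Import finmap.
From mathcomp Require Import all_classical.

Set Implicit Arguments.
Unset Strict Implicit.
Unset Printing Implicit Defensive.
Import Order.TTheory GRing.Theory.

Local Open Scope classical_set_scope.
Local Open Scope ring_scope.

Section IncidenceSpace.
Context {d : Order.disp_t} (X : porderType d) (K : fieldType).

Definition is_incidence (f : X -> X -> K) : Prop :=
  forall x y, ~~ (x <= y)%O -> f x y = 0.

Definition incidence_pred : pred (X -> X -> K) :=
  fun f => `[< is_incidence f >].

Record incidence : Type := Incidence {
  incidence_fun :> X -> X -> K;
  _ : incidence_pred incidence_fun }.

HB.instance Definition _ := [isSub for incidence_fun].
HB.instance Definition _ := [Choice of incidence by <:].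

Lemma incidence_out (f : incidence) x y : ~~ (x <= y)%O -> f x y = 0.
Proof. by case: f => f /= /asboolP; apply. Qed.

Lemma incidence_supp (f : incidence) x y : f x y != 0 -> (x <= y)%O.
Proof. by move=> nz; apply: contraNT nz => /incidence_out->. Qed.

Lemma incidence_ext (f g : incidence) : (forall x y, f x y = g x y) -> f = g.
Proof. by move=> fg; apply/val_inj/funext => x; apply/funext => y; exact: fg. Qed.

Definition mk_incidence (f : X -> X -> K) (hf : is_incidence f) : incidence :=
  @Incidence f (asboolT hf).

Fact incidence_zmod_closed : zmod_closed incidence_pred.
Proof.
split=> [|f g]; first by apply/asboolP.
move=> /asboolP hf /asboolP hg; apply/asboolP => x y xy.
by rewrite /GRing.add /= /GRing.add /= /GRing.opp /= /GRing.opp /=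
           hf // hg // subr0.
Qed.

HB.instance Definition _ := GRing.isZmodClosed.Build (X -> X -> K)
  incidence_pred incidence_zmod_closed.
HB.instance Definition _ := [SubChoice_isSubZmodule of incidence by <:].

Lemma incidence0E x y : (0 : incidence) x y = 0. Proof. by []. Qed.
Lemma incidenceDE (f g : incidence) x y : (f + g) x y = f x y + g x y.
Proof. by []. Qed.
Lemma incidenceNE (f : incidence) x y : (- f) x y = - f x y.
Proof. by []. Qed.

Fact scale_is_incidence (k : K) (f : incidence) :
  is_incidence (fun x y => k * f x y).
Proof. by move=> x y xy; rewrite incidence_out ?mulr0. Qed.

Definition incidence_scale k f := mk_incidence (@scale_is_incidence k f).

Fact incidence_scaleA a b f :
  incidence_scale a (incidence_scale b f) = incidence_scale (a * b) f.
Proof. by apply: incidence_ext => x y /=; rewrite mulrA. Qed.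
Fact incidence_scale1 : left_id 1 incidence_scale.
Proof. by move=> f; apply: incidence_ext => x y /=; rewrite mul1r. Qed.
Fact incidence_scaleDr : right_distributive incidence_scale +%R.
Proof.
by move=> k f g; apply: incidence_ext => x y; rewrite incidenceDE /= mulrDr.
Qed.
Fact incidence_scaleDl f : {morph incidence_scale^~ f : a b / a + b}.
Proof.
by move=> a b; apply: incidence_ext => x y; rewrite incidenceDE /= mulrDl.
Qed.

HB.instance Definition _ := GRing.Zmodule_isLmodule.Build K incidence
  incidence_scaleA incidence_scale1 incidence_scaleDr incidence_scaleDl.

Lemma incidenceZE (k : K) (f : incidence) x y : (k *: f) x y = k * f x y.
Proof. by []. Qed.

(* The sum over the possibly infinite interval [x, y] is a finitely supported *)
(* one, with the junk value 0 if the support is infinite; by [conv_fin_suppl] *)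
(* and [conv_fin_suppr] below this never happens when f or g is finitary.     *)
Fact conv_is_incidence (f g : incidence) : is_incidence
  (fun x y => \sum_(z \in [set z | (x <= z <= y)%O]) f x z * g z y).
Proof.
move=> x y xy; apply: fsbig1 => z /andP[xz zy].
by rewrite (le_trans xz zy) in xy.
Qed.

Definition conv (f g : incidence) : incidence :=
  mk_incidence (@conv_is_incidence f g).

(* A nonempty interval [u, v] determines the pair (u, v), and is included in  *)
(* [x, y] iff x <= u and v <= y.                                              *)
Definition fin_supp (f : incidence) (x y : X) : set (X * X) :=
  [set p | [/\ (x <= p.1)%O, (p.1 <= p.2)%O, (p.2 <= y)%O, p.1 != p.2 &
               f p.1 p.2 != 0]].

Definition finitary (f : incidence) : Prop :=
  forall x y : X, (x <= y)%O -> finite_set (fin_supp f x y).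

Lemma fin_suppl (f : incidence) x y : finitary f -> (x <= y)%O ->
  finite_set [set z | (z <= y)%O /\ f x z != 0].
Proof.
move=> ff xy; apply: (@sub_finite_set _ _ (snd @` fin_supp f x y `|` [set x])).
  move=> z [zy nz]; have xz := incidence_supp nz.
  have [->|xNz] := eqVneq z x; [by right | left; exists (x, z) => //].
  by split=> //=; rewrite eq_sym.
by rewrite finite_setU; split=> //; apply/finite_image/ff.
Qed.

Lemma fin_suppr (f : incidence) x y : finitary f -> (x <= y)%O ->
  finite_set [set z | (x <= z)%O /\ f z y != 0].
Proof.
move=> ff xy; apply: (@sub_finite_set _ _ (fst @` fin_supp f x y `|` [set y])).
  move=> z [xz nz]; have zy := incidence_supp nz.
  have [->|zNy] := eqVneq z y; [by right | left; exists (z, y) => //].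
by rewrite finite_setU; split=> //; apply/finite_image/ff.
Qed.

Lemma conv_fin_suppl (f g : incidence) x y : finitary f ->
  finite_set [set z | f x z * g z y != 0].
Proof.
move=> ff; have [xy|xy] := boolP (x <= y)%O.
  apply: sub_finite_set (fin_suppl ff xy) => z /=.
  by rewrite mulf_eq0 negb_or => /andP[nzf /incidence_supp].
apply: sub_finite_set (finite_set0 X) => z /=.
rewrite mulf_eq0 negb_or => /andP[/incidence_supp xz /incidence_supp zy].
by rewrite (le_trans xz zy) in xy.
Qed.

Lemma conv_fin_suppr (f g : incidence) x y : finitary g ->
  finite_set [set z | f x z * g z y != 0].
Proof.
move=> fg; have [xy|xy] := boolP (x <= y)%O.
  apply: sub_finite_set (fin_suppr fg xy) => z /=.
  by rewrite mulf_eq0 negb_or => /andP[/incidence_supp].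
apply: sub_finite_set (finite_set0 X) => z /=.
rewrite mulf_eq0 negb_or => /andP[/incidence_supp xz /incidence_supp zy].
by rewrite (le_trans xz zy) in xy.
Qed.

Lemma convE (s : seq X) (f g : incidence) x y : uniq s ->
    (forall z, f x z * g z y != 0 -> z \in s) ->
  conv f g x y = \sum_(z <- s) f x z * g z y.
Proof.
move=> us hs /=; rewrite (fsbig_widen _ setT) //; last first.
  move=> z /= [_ nxy]; apply/eqP; apply: contra_notT nxy.
  by rewrite mulf_eq0 negb_or => /andP[/incidence_supp-> /incidence_supp->].
rewrite (fsbigE s) //; first by apply: eq_bigl => z; rewrite in_setT.
by move=> z _ zs; apply/eqP; apply: contraNT zs => /hs.
Qed.

Lemma finite_uniq_seq (T : choiceType) (A : set T) : finite_set A ->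
  exists2 s : seq T, uniq s & forall z, A z -> z \in s.
Proof.
move=> /finite_fsetP[B ->]; exists (enum_fset B); first exact: fset_uniq.
by [].
Qed.

Lemma conv_neq0 (f g : incidence) x y : conv f g x y != 0 ->
  exists2 z, f x z != 0 & g z y != 0.
Proof.
move=> nz; apply: contrapT => h; move/eqP: nz; apply; apply: fsbig1 => z _.
have [->|nf] := eqVneq (f x z) 0; first by rewrite mul0r.
have [->|ng] := eqVneq (g z y) 0; first by rewrite mulr0.
by case: h; exists z.
Qed.

Lemma convA_at (f g h : incidence) x y :
    finite_set [set p : X * X | f x p.1 * g p.1 p.2 * h p.2 y != 0] ->
  conv (conv f g) h x y = conv f (conv g h) x y.
Proof.
move=> fS.
have [zs uz hz] := finite_uniq_seq (finite_image fst fS).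
have [ws uw hw] := finite_uniq_seq (finite_image snd fS).
have inz z w : f x z * g z w * h w y != 0 -> z \in zs.
  by move=> nz; apply: hz; exists (z, w).
have inw z w : f x z * g z w * h w y != 0 -> w \in ws.
  by move=> nz; apply: hw; exists (z, w).
rewrite (convE uw); last first.
  move=> w; rewrite mulf_eq0 negb_or => /andP[/conv_neq0[z nf ng] nh].
  by apply: (inw z); rewrite !mulf_neq0.
rewrite (convE uz); last first.
  move=> z; rewrite mulf_eq0 negb_or => /andP[nf /conv_neq0[w ng nh]].
  by apply: (inz _ w); rewrite !mulf_neq0.
transitivity (\sum_(w <- ws) \sum_(z <- zs) f x z * g z w * h w y).
  apply: eq_bigr => w _; have [->|nh] := eqVneq (h w y) 0.
    by rewrite mulr0 big1 // => z _; rewrite mulr0.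
  by rewrite (convE uz) ?mulr_suml // => z nz; apply: (inz z w); rewrite mulf_neq0.
rewrite exchange_big; apply: eq_bigr => z _.
have [->|nf] := eqVneq (f x z) 0.
  by rewrite mul0r big1 // => w _; rewrite !mul0r.
rewrite (convE uw) ?mulr_sumr; first by apply: eq_bigr => w _; rewrite mulrA.
by move=> w nz; apply: (inw z w); rewrite -mulrA mulf_neq0.
Qed.

Lemma triple_supp (f g h : incidence) x y z w :
    f x z * g z w * h w y != 0 ->
  [/\ f x z != 0, g z w != 0, h w y != 0 & [/\ (x <= z)%O, (z <= w)%O & (w <= y)%O]].
Proof.
rewrite !mulf_eq0 !negb_or => /andP[/andP[nf ng] nh].
by split=> //; split; apply: incidence_supp; eassumption.
Qed.

(* Of three factors, two finitary ones suffice for associativity. *)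
Lemma convA12 (f g h : incidence) : finitary f -> finitary g ->
  conv (conv f g) h = conv f (conv g h).
Proof.
move=> ff fg; apply: incidence_ext => x y; apply: convA_at.
have [xy|xy] := boolP (x <= y)%O; last first.
  apply: sub_finite_set (finite_set0 _) => -[z w] /= /triple_supp[_ _ _].
  by move=> [xz zw wy]; rewrite (le_trans xz (le_trans zw wy)) in xy.
pose Z := [set z | (z <= y)%O /\ f x z != 0].
pose W z := [set w | (z <= y)%O /\ (w <= y)%O /\ g z w != 0].
apply: (@sub_finite_set _ _ (\bigcup_(z in Z) [set (z, w) | w in W z])).
  move=> [z w] /= /triple_supp[nf ng nh [xz zw wy]].
  by exists z; [split=> //; apply: le_trans wy | exists w => //; split=> //; apply: le_trans wy].
apply: bigcup_finite; first exact: fin_suppl.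
move=> z [zy _]; apply: finite_image.
by apply: sub_finite_set (fin_suppl fg zy) => w [].
Qed.

Lemma convA23 (f g h : incidence) : finitary g -> finitary h ->
  conv (conv f g) h = conv f (conv g h).
Proof.
move=> fg fh; apply: incidence_ext => x y; apply: convA_at.
have [xy|xy] := boolP (x <= y)%O; last first.
  apply: sub_finite_set (finite_set0 _) => -[z w] /= /triple_supp[_ _ _].
  by move=> [xz zw wy]; rewrite (le_trans xz (le_trans zw wy)) in xy.
pose W := [set w | (x <= w)%O /\ h w y != 0].
pose Z w := [set z | (x <= z)%O /\ g z w != 0].
apply: (@sub_finite_set _ _ (\bigcup_(w in W) [set (z, w) | z in Z w])).
  move=> [z w] /= /triple_supp[nf ng nh [xz zw wy]].
  by exists w; [split=> //; apply: le_trans zw | exists z].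
apply: bigcup_finite; first exact: fin_suppr.
by move=> w [xw _]; apply/finite_image/fin_suppr.
Qed.

Lemma convA13 (f g h : incidence) : finitary f -> finitary h ->
  conv (conv f g) h = conv f (conv g h).
Proof.
move=> ff fh; apply: incidence_ext => x y; apply: convA_at.
have [xy|xy] := boolP (x <= y)%O; last first.
  apply: sub_finite_set (finite_set0 _) => -[z w] /= /triple_supp[_ _ _].
  by move=> [xz zw wy]; rewrite (le_trans xz (le_trans zw wy)) in xy.
apply: sub_finite_set (finite_setX (fin_suppl ff xy) (fin_suppr fh xy)).
move=> [z w] /= /triple_supp[nf ng nh [xz zw wy]].
by split; split=> //=; [apply: le_trans wy | apply: le_trans zw].
Qed.

(* Additivity only needs the supports at hand to be finite. *)
Lemma convDl_at (f g h : incidence) x y :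
    finite_set [set z | f x z * h z y != 0] ->
    finite_set [set z | g x z * h z y != 0] ->
  conv (f + g) h x y = conv f h x y + conv g h x y.
Proof.
move=> /finite_uniq_seq[s us hs] /finite_uniq_seq[t ut ht].
have ur : uniq (undup (s ++ t)) by exact: undup_uniq.
have hr z : z \in s \/ z \in t -> z \in undup (s ++ t).
  by rewrite mem_undup mem_cat => -[] ->; rewrite ?orbT.
have hfr z : f x z * h z y != 0 -> z \in undup (s ++ t).
  by move=> nz; apply: hr; left; apply: hs.
have hgr z : g x z * h z y != 0 -> z \in undup (s ++ t).
  by move=> nz; apply: hr; right; apply: ht.
rewrite !(convE ur) //; first by rewrite -big_split; apply: eq_bigr => z _; rewrite mulrDl.
move=> z; rewrite incidenceDE mulrDl; have [->|/hfr//] := eqVneq (f x z * h z y) 0.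
by rewrite add0r => /hgr.
Qed.

Lemma convDr_at (f g h : incidence) x y :
    finite_set [set z | h x z * f z y != 0] ->
    finite_set [set z | h x z * g z y != 0] ->
  conv h (f + g) x y = conv h f x y + conv h g x y.
Proof.
move=> /finite_uniq_seq[s us hs] /finite_uniq_seq[t ut ht].
have ur : uniq (undup (s ++ t)) by exact: undup_uniq.
have hr z : z \in s \/ z \in t -> z \in undup (s ++ t).
  by rewrite mem_undup mem_cat => -[] ->; rewrite ?orbT.
have hfr z : h x z * f z y != 0 -> z \in undup (s ++ t).
  by move=> nz; apply: hr; left; apply: hs.
have hgr z : h x z * g z y != 0 -> z \in undup (s ++ t).
  by move=> nz; apply: hr; right; apply: ht.
rewrite !(convE ur) //; first by rewrite -big_split; apply: eq_bigr => z _; rewrite mulrDr.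
move=> z; rewrite incidenceDE mulrDr; have [->|/hfr//] := eqVneq (h x z * f z y) 0.
by rewrite add0r => /hgr.
Qed.

Lemma convDl_finl (f g h : incidence) : finitary f -> finitary g ->
  conv (f + g) h = conv f h + conv g h.
Proof.
by move=> ff fg; apply: incidence_ext => x y; apply: convDl_at; apply: conv_fin_suppl.
Qed.
Lemma convDl_finr (f g h : incidence) : finitary h ->
  conv (f + g) h = conv f h + conv g h.
Proof.
by move=> fh; apply: incidence_ext => x y; apply: convDl_at; apply: conv_fin_suppr.
Qed.
Lemma convDr_finl (f g h : incidence) : finitary h ->
  conv h (f + g) = conv h f + conv h g.
Proof.
by move=> fh; apply: incidence_ext => x y; apply: convDr_at; apply: conv_fin_suppl.
Qed.
Lemma convDr_finr (f g h : incidence) : finitary f -> finitary g ->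
  conv h (f + g) = conv h f + conv h g.
Proof.
by move=> ff fg; apply: incidence_ext => x y; apply: convDr_at; apply: conv_fin_suppr.
Qed.

Lemma convZl (k : K) (f g : incidence) : conv (k *: f) g = k *: conv f g.
Proof.
apply: incidence_ext => x y /=; rewrite mulr_fsumr.
by apply: eq_fsbigr => z _; rewrite mulrA.
Qed.
Lemma convZr (k : K) (f g : incidence) : conv f (k *: g) = k *: conv f g.
Proof.
apply: incidence_ext => x y /=; rewrite mulr_fsumr.
by apply: eq_fsbigr => z _; rewrite mulrCA.
Qed.

Lemma conv0l f : conv 0 f = 0.
Proof. by rewrite -(scale0r (0 : incidence)) convZl !scale0r. Qed.
Lemma conv0r f : conv f 0 = 0.
Proof. by rewrite -(scale0r (0 : incidence)) convZr !scale0r. Qed.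

Fact delta_is_incidence :
  is_incidence (fun x y : X => if x == y then 1 else 0).
Proof. by move=> x y; case: eqP => // ->; rewrite lexx. Qed.

Definition delta : incidence := mk_incidence delta_is_incidence.

Lemma conv1l f : conv delta f = f.
Proof.
apply: incidence_ext => x y; rewrite (@convE [:: x]) //=.
  by rewrite big_seq1 eqxx mul1r.
by move=> z; rewrite inE; have [->//|_] := eqVneq z x; rewrite mul0r eqxx.
Qed.

Lemma conv1r f : conv f delta = f.
Proof.
apply: incidence_ext => x y; rewrite (@convE [:: y]) //=.
  by rewrite big_seq1 eqxx mulr1.
by move=> z; rewrite inE; have [->//|zy] := eqVneq z y; rewrite mulr0 eqxx.
Qed.

Lemma finitary_delta : finitary delta.
Proof.
move=> x y _; apply: sub_finite_set (finite_set0 _) => -[u v] /= [_ _ _].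
by move=> /= uv; rewrite (negPf uv) eqxx.
Qed.

Lemma finitary_conv f g : finitary f -> finitary g -> finitary (conv f g).
Proof.
move=> ff fg x y xy.
pose A := fin_supp f x y; pose B := fin_supp g x y.
apply: (@sub_finite_set _ _
  (A `|` B `|` [set (p.1.1, p.2.2) | p in A `*` B])); last first.
  rewrite !finite_setU; do !split; rewrite ?/A ?/B; [exact: ff|exact: fg|].
  by apply/finite_image/finite_setX; [exact: ff|exact: fg].
move=> [u v] /= [xu uv vy uNv /conv_neq0[z nf ng]].
have uz := incidence_supp nf; have zv := incidence_supp ng.
have xz := le_trans xu uz; have zy := le_trans zv vy.
have [zu|uNz] := eqVneq u z; first by subst z; left; right.
have [vz|zNv] := eqVneq z v; first by subst z; left; left.
by right; exists ((u, z), (z, v)).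
Qed.

Lemma finitary0 : finitary 0.
Proof.
by move=> x y _; apply: sub_finite_set (finite_set0 _) => -[u v] /= [_ _ _ _]; rewrite eqxx.
Qed.

Lemma finitaryD f g : finitary f -> finitary g -> finitary (f + g).
Proof.
move=> ff fg x y xy; apply: (@sub_finite_set _ _ (fin_supp f x y `|` fin_supp g x y)).
  move=> [u v] /= [xu uv vy uNv nz].
  have [f0|nf] := eqVneq (f u v) 0; last by left.
  by right; split=> //=; move: nz; rewrite incidenceDE f0 add0r.
by rewrite finite_setU; split; [exact: ff|exact: fg].
Qed.

Lemma finitaryZ k f : finitary f -> finitary (k *: f).
Proof.
move=> ff x y xy; apply: sub_finite_set (ff x y xy) => -[u v] /= [xu uv vy uNv].
by rewrite mulf_eq0 negb_or => /andP[].
Qed.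

Definition finitary_pred : pred incidence := fun f => `[< finitary f >].

Record finc : Type := Finc {
  finc_val :> incidence;
  _ : finitary_pred finc_val }.

HB.instance Definition _ := [isSub for finc_val].
HB.instance Definition _ := [Choice of finc by <:].

Lemma fincP (f : finc) : finitary f.
Proof. by case: f => f /= /asboolP. Qed.

Definition mk_finc (f : incidence) (hf : finitary f) : finc :=
  @Finc f (asboolT hf).

Fact finc_submod_closed : submod_closed finitary_pred.
Proof.
split=> [|k f g]; first by apply/asboolP/finitary0.
by move=> /asboolP ff /asboolP fg; apply/asboolP/finitaryD => //; apply: finitaryZ.
Qed.

HB.instance Definition _ := GRing.isSubmodClosed.Build K incidence
  finitary_pred finc_submod_closed.
HB.instance Definition _ := [SubChoice_isSubLmodule of finc by <:].

Definition finc_one : finc := mk_finc finitary_delta.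
Definition finc_mul (f g : finc) : finc :=
  mk_finc (finitary_conv (fincP f) (fincP g)).

Fact finc_mulA : associative finc_mul.
Proof.
by move=> f g h; apply: val_inj; rewrite /= convA12 //; apply: fincP.
Qed.
Fact finc_mul1l : left_id finc_one finc_mul.
Proof. by move=> f; apply: val_inj; rewrite /= conv1l. Qed.
Fact finc_mul1r : right_id finc_one finc_mul.
Proof. by move=> f; apply: val_inj; rewrite /= conv1r. Qed.
Fact finc_mulDl : left_distributive finc_mul +%R.
Proof. by move=> f g h; apply: val_inj; rewrite /= convDl_finr //; apply: fincP. Qed.
Fact finc_mulDr : right_distributive finc_mul +%R.
Proof. by move=> f g h; apply: val_inj; rewrite /= convDr_finl //; apply: fincP. Qed.

HB.instance Definition _ := GRing.Zmodule_isPzRing.Build finc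
  finc_mulA finc_mul1l finc_mul1r finc_mulDl finc_mulDr.

Lemma finc_scalerAl (k : K) (f g : finc) : k *: (f * g) = (k *: f) * g.
Proof. by apply: val_inj; rewrite /= convZl. Qed.
Lemma finc_scalerAr (k : K) (f g : finc) : k *: (f * g) = f * (k *: g).
Proof. by apply: val_inj; rewrite /= convZr. Qed.

Definition dalg : Type := (finc * incidence)%type.

HB.instance Definition _ := GRing.Lmodule.on dalg.

Definition dalg_one : dalg := (1, 0).
Definition dalg_mul (a b : dalg) : dalg :=
  (a.1 * b.1, conv a.1 b.2 + conv a.2 b.1).

Fact dalg_mulA : associative dalg_mul.
Proof.
move=> [f i] [g j] [h l]; congr pair; rewrite /= ?mulrA //.
rewrite (convDr_finl _ _ (fincP f)) (convDl_finr _ _ (fincP h)) addrA.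
by rewrite (convA12 l (fincP f) (fincP g)) (convA13 j (fincP f) (fincP h))
           (convA23 i (fincP g) (fincP h)).
Qed.
Fact dalg_mul1l : left_id dalg_one dalg_mul.
Proof.
move=> [f i]; congr pair; rewrite /= ?mul1r // conv1l.
by rewrite conv0l addr0.
Qed.
Fact dalg_mul1r : right_id dalg_one dalg_mul.
Proof.
move=> [f i]; congr pair; rewrite /= ?mulr1 // conv1r.
by rewrite conv0r add0r.
Qed.
Fact dalg_mulDl : left_distributive dalg_mul +%R.
Proof.
move=> [f i] [g j] [h l]; congr pair; rewrite /=; first exact: mulrDl.
rewrite (convDl_finl l (fincP f) (fincP g)) (convDl_finr i j (fincP h)).
exact: addrACA.
Qed.
Fact dalg_mulDr : right_distributive dalg_mul +%R.
Proof.
move=> [f i] [g j] [h l]; congr pair; rewrite /=; first exact: mulrDr.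
rewrite (convDr_finl j l (fincP f)) (convDr_finr i (fincP g) (fincP h)).
exact: addrACA.
Qed.

HB.instance Definition _ := GRing.Zmodule_isPzRing.Build dalg
  dalg_mulA dalg_mul1l dalg_mul1r dalg_mulDl dalg_mulDr.

Lemma dalg_scalerAl (k : K) (a b : dalg) : k *: (a * b) = (k *: a) * b.
Proof. by congr pair; rewrite /= ?finc_scalerAl // scalerDr !convZl. Qed.
Lemma dalg_scalerAr (k : K) (a b : dalg) : k *: (a * b) = a * (k *: b).
Proof. by congr pair; rewrite /= ?finc_scalerAr // scalerDr !convZr. Qed.

End IncidenceSpace.

(* For X empty, FI(X,K) and D(X,K) are zero rings, which MathComp's algType   *)
(* and unitRingType exclude. So units are spelled out as two-sided invertible *)
(* elements, and a K-algebra morphism is a ring morphism that is scalable.    *)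
Definition inner_automorphism (R : pzRingType) (phi : R -> R) : Prop :=
  exists u v : R, [/\ u * v = 1, v * u = 1 & forall a, phi a = u * a * v].

Definition dalg_automorphism d (X : porderType d) (K : fieldType)
    (phi : {rmorphism dalg X K -> dalg X K}) : Prop :=
  scalable phi /\ bijective phi.

Definition connected_poset d (X : porderType d) : Prop :=
  forall x y : X, exists s : seq X,
    path (fun a b => (a >=< b)%O) x s /\ last x s = y.

Definition multiplicative_automorphism d (X : porderType d) (K : fieldType)
    (phi : finc X K -> finc X K) : Prop :=
  exists sigma : incidence X K,
    [/\ forall x y, (x <= y)%O -> sigma x y != 0,
        forall x y z, (x <= y <= z)%O -> sigma x y * sigma y z = sigma x z &
        forall f x y, phi f x y = sigma x y * f x y].

Definition derivation d (X : porderType d) (K : fieldType)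
    (D : {linear finc X K -> incidence X K}) : Prop :=
  forall f g : finc X K, D (f * g) = conv (D f) g + conv f (D g).

Definition inner_derivation d (X : porderType d) (K : fieldType)
    (D : finc X K -> incidence X K) : Prop :=
  exists i : incidence X K, forall f, D f = conv f i - conv i f.

Definition all_multiplicative_inner d (X : porderType d) (K : fieldType) : Prop :=
  forall phi : finc X K -> finc X K,
    multiplicative_automorphism phi -> inner_automorphism phi.

Definition all_derivations_inner d (X : porderType d) (K : fieldType) : Prop :=
  forall D : {linear finc X K -> incidence X K},
    derivation D -> inner_derivation D.

Record poset_aut d (X : porderType d) : Type := PosetAut {
  aut_fun :> X -> X;
  aut_inv : X -> X;
  aut_funK : cancel aut_fun aut_inv;
  aut_invK : cancel aut_inv aut_fun;
  aut_mono : {mono aut_fun : x y / (x <= y)%O} }.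

Section Tilde.
Context {d : Order.disp_t} {X : porderType d} {K : fieldType}.
Variable alpha : poset_aut X.
Local Notation alphaV := (aut_inv alpha).

Lemma aut_inv_mono : {mono alphaV : x y / (x <= y)%O}.
Proof. by move=> x y; rewrite -(aut_mono alpha) !aut_invK. Qed.

Fact tilde_is_incidence (i : incidence X K) :
  is_incidence (fun x y => i (alphaV x) (alphaV y)).
Proof. by move=> x y xy; apply: incidence_out; rewrite aut_inv_mono. Qed.

Definition tilde_incidence i := mk_incidence (@tilde_is_incidence i).

Fact tilde_finitary (f : finc X K) : finitary (tilde_incidence f).
Proof.
move=> x y xy; apply: (@sub_finite_set _ _
  ((fun p => (alpha p.1, alpha p.2)) @` fin_supp f (alphaV x) (alphaV y))).
  move=> [u v] /= [xu uv vy uNv nz]; exists (alphaV u, alphaV v).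
    split=> //=; rewrite ?aut_inv_mono //.
    by rewrite (can_eq (aut_invK alpha)).
  by rewrite /= !aut_invK.
by apply: finite_image; apply: fincP; rewrite aut_inv_mono.
Qed.

Definition tilde_finc f := mk_finc (@tilde_finitary f).

Definition tilde_aut (a : dalg X K) : dalg X K :=
  (tilde_finc a.1, tilde_incidence a.2).

End Tilde.

Definition tilde_scale d (X : porderType d) (K : fieldType) (k : K)
  (a : dalg X K) : dalg X K := (a.1, k *: a.2).

(* Main.v *)
From HB Require Import structures.
Require Import Defs.
From mathcomp Require Import all_boot all_order all_algebra.
From mathcomp Require Import all_classical.
Set Implicit Arguments.
Unset Strict Implicit.
Unset Printing Implicit Defensive.
Import Order.TTheory GRing.Theory.
Local Open Scope classical_set_scope.
Local Open Scope ring_scope.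

(** Write e_x for the idempotent of FI(X,K) with the single entry 1 at (x, x),
E_xy for the matrix unit at (x, y), and eps for the element (0, delta) of
D(X,K), so that eps * eps = 0.

The element eps is central, and on a connected poset a function that commutes
with all of FI(X,K) is a scalar multiple of delta. Hence an automorphism phi
maps eps to k eps with k nonzero ([aut_eps]), and it preserves the annihilator
of eps, which is exactly the ideal 0 + I(X,K) ([aut_ideal]). After composing
with the inverse scaling one may take phi eps = eps, and phi then induces an
automorphism chi of the quotient FI(X,K) ([finc_part_aut]).

An automorphism chi of FI(X,K) is put in standard form as follows. Each
chi(e_x) is an idempotent f with f FI f = K f. Such an f is 1 at exactly one
place alpha(x) of the diagonal, because a finitary idempotent with zero
diagonal vanishes ([idempotent_diag0]); and alpha is an automorphism of X
([finc_aut_poset]). Once alpha is composed away, the function u whose column b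
is the column b of chi(e_b), and the function w whose row a is the row a of
chi(e_a), satisfy wu = delta and chi(e_x) u = u e_x. The delicate point is that
u is finitary ([finitary_straightening]). It rests on applying chi to the
diagonal idempotent e_S of an arbitrary subset S of X: as chi(e_S) chi(e_b) is
chi(e_b) or 0 according to whether b is in S or not, finitariness of chi(e_S)
makes finite the set of those rows a not in S in which u has a nonzero entry
(a, b) in a given interval with b in S. A well chosen S gives finitely many
nonzero rows, then finitely many entries in each row. Since w is a left inverse
of u, it is finitary too ([finitary_left_inverse]), and delta - uw is an
idempotent with zero diagonal, so w is a two-sided inverse. Conjugating by u,
one may take chi(e_x) = e_x for all x, and then chi is multiplicative
([finc_aut_multiplicative]), hence inner by hypothesis.

Conjugating once more, phi(f, 0) = (f, D f), where D is a derivation, hence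
D f = f i - i f for some i, and phi(0, j) = (0, j) by comparing entries; so phi
is conjugation by (delta, -i) ([aut_inner_of_derivations]).

If x0 is comparable with all elements, a multiplicative sigma is the coboundary
h(x)^-1 h(y) with h(x) = sigma(x0, x) or sigma(x, x0)^-1. A derivation differs
from an inner one by a derivation vanishing at all e_x, which multiplies
entries by an additive function t(x, y); and t is handled like sigma. *)

(** * Automorphisms of algebras *)

Section AlgebraAutomorphism.
Variables (K A : pzRingType) (sc : K -> A -> A).

(** Automorphisms of the ring [A] that commute with a scalar multiplication
[sc]. The unit is preserved automatically, by bijectivity. The operation [sc]
is a parameter so that rings which may be zero are covered. *)
Definition algebra_automorphism (f : A -> A) : Prop :=
  [/\ {morph f : a b / a + b}, {morph f : a b / a * b},
      forall k a, f (sc k a) = sc k (f a) & bijective f].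

Lemma aut0 f : algebra_automorphism f -> f 0 = 0.
Proof. by case=> fD _ _ _; apply: (addrI (f 0)); rewrite -fD !addr0. Qed.

Lemma aut_inj f : algebra_automorphism f -> injective f.
Proof. by case=> _ _ _ /bij_inj. Qed.

Lemma aut_comp f g : algebra_automorphism f -> algebra_automorphism g ->
  algebra_automorphism (f \o g).
Proof.
move=> [fD fM fZ fb] [gD gM gZ gb]; split=> /=; last exact: bij_comp.
- by move=> a b /=; rewrite gD fD.
- by move=> a b /=; rewrite gM fM.
- by move=> k a; rewrite gZ fZ.
Qed.

Lemma aut_can f g : algebra_automorphism f -> cancel f g -> cancel g f ->
  algebra_automorphism g.
Proof.
move=> [fD fM fZ fb] fK gK; split; last by exists f.
- by move=> a b; apply: (bij_inj fb); rewrite fD !gK.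
- by move=> a b; apply: (bij_inj fb); rewrite fM !gK.
- by move=> k a; apply: (bij_inj fb); rewrite fZ !gK.
Qed.

Hypothesis scAl : forall k a b, sc k (a * b) = sc k a * b.
Hypothesis scAr : forall k a b, sc k (a * b) = a * sc k b.

Lemma aut_conj u v : u * v = 1 -> v * u = 1 ->
  algebra_automorphism (fun a => u * a * v).
Proof.
move=> uv vu; split=> [a b|a b|k a|].
- by rewrite mulrDr mulrDl.
- by rewrite !mulrA -[_ * v * u]mulrA vu mulr1.
- by rewrite -scAr -scAl.
- by exists (fun a => v * a * u) => a; rewrite !mulrA ?uv ?vu mul1r -mulrA ?uv ?vu mulr1.
Qed.

End AlgebraAutomorphism.

(** * Induction over a finite set *)

Section FiniteInduction.
Variable (T : choiceType).

(** Well-founded induction along a strict order [R] (with [R b a] meaning that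
[b] is smaller), where only the smaller elements in the finite set [A] matter. *)
Lemma finite_set_ind (R : rel T) (A : set T) (Q : T -> Prop) :
    irreflexive R -> transitive R -> finite_set A ->
    (forall a, (forall b, A b -> R b a -> Q b) -> Q a) ->
  forall a, Q a.
Proof.
move=> Rirr Rtr /finite_uniq_seq[s _ sP] step a.
(* The induction is on the number of elements of A below a. *)
have [n] := ubnP (count (R^~ a) s); elim: n a => // n IHn a an.
apply: step => b /sP bs ba; apply: IHn; rewrite ltnS in an; apply: leq_trans an.
have /(sub_count) le_ab : subpred (predU (R^~ b) (pred1 b)) (R^~ a).
  by move=> c /= /orP[/Rtr|/eqP->]; [apply|].
apply: leq_trans (le_ab s); have := count_predUI (R^~ b) (pred1 b) s.
rewrite [count (predI _ _) s](@eq_count _ _ pred0) ?count_pred0 ?addn0.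
  by move=> ->; rewrite -addn1 leq_add2l -has_count has_pred1.
by move=> c /=; case: eqP => [->|]; rewrite ?Rirr ?andbF.
Qed.

End FiniteInduction.

(** * Diagonal functions, matrix units, local nilpotence *)

Section Incidence.
Context {d : Order.disp_t} {X : porderType d} {K : fieldType}.
Implicit Types (x y z : X) (f g : finc X K) (i j : incidence X K).

Lemma conv_diag i j x : conv i j x x = i x x * j x x.
Proof.
rewrite (@convE _ _ _ [:: x]) ?big_seq1 // => z.
rewrite mulf_eq0 negb_or inE => /andP[/incidence_supp xz /incidence_supp zx].
by apply/eqP/le_anti; rewrite xz zx.
Qed.

Fact diag_is_incidence (h : X -> K) :
  is_incidence (fun x y => if x == y then h x else 0).
Proof. by move=> x y; case: eqP => // ->; rewrite lexx. Qed.

Definition diag_incidence h := mk_incidence (@diag_is_incidence h).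

Fact finitary_diag h : finitary (diag_incidence h).
Proof.
move=> x y _; apply: sub_finite_set (finite_set0 _) => -[u v] /= [_ _ _].
by move=> /= uv; rewrite (negPf uv) eqxx.
Qed.

(** The diagonal function with entries [h]. *)
Definition diag_finc (h : X -> K) : finc X K := mk_finc (finitary_diag h).

Lemma conv_diagl h i x y : conv (diag_finc h) i x y = h x * i x y.
Proof.
rewrite (@convE _ _ _ [:: x]) //= ?big_seq1 ?eqxx // => z.
by rewrite inE; have [->//|_] := eqVneq z x; rewrite mul0r eqxx.
Qed.

Lemma conv_diagr h i x y : conv i (diag_finc h) x y = i x y * h y.
Proof.
rewrite (@convE _ _ _ [:: y]) //= ?big_seq1 ?eqxx // => z.
by rewrite inE; have [->//|_] := eqVneq z y; rewrite mulr0 eqxx.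
Qed.

(** The diagonal idempotent of the set [p]; [e_ x] is that of a singleton. *)
Definition idem (p : pred X) : finc X K := diag_finc (fun a => (p a)%:R).
Notation e_ x := (idem (pred1 x)).

Lemma conv_idem2 p q i x y :
  conv (conv (idem p) i) (idem q) x y = (p x && q y)%:R * i x y.
Proof. by rewrite conv_diagr conv_diagl mulrAC -natrM mulnb. Qed.

Fact munit_is_incidence (x y : X) :
  is_incidence (fun a b => if [&& (x <= y)%O, a == x & b == y] then 1 else 0 : K).
Proof. by move=> a b; case: ifP => // /and3P[xy /eqP-> /eqP->]; rewrite xy. Qed.

Definition munit_incidence x y := mk_incidence (@munit_is_incidence x y).

Fact finitary_munit x y : finitary (munit_incidence x y).
Proof.
move=> u v _; apply: sub_finite_set (finite_set1 (x, y)) => -[a b] /=.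
move=> [_ _ _ _]; rewrite /=; case: ifP => [/and3P[_ /eqP-> /eqP->]|_] //.
by rewrite eqxx.
Qed.

(** The matrix unit at [(x, y)], which is [0] unless [x <= y]. *)
Definition munit (x y : X) : finc X K := mk_finc (finitary_munit x y).

Lemma munitE x y a b : munit x y a b = [&& (x <= y)%O, a == x & b == y]%:R.
Proof. by rewrite /=; case: ifP. Qed.

Lemma conv_munitl x y i a b : (x <= y)%O ->
  conv (munit x y) i a b = (a == x)%:R * i y b.
Proof.
move=> xy; rewrite (@convE _ _ _ [:: y]) //= ?big_seq1 ?xy ?eqxx ?andbT //=.
  by case: ifP; rewrite ?mul1r ?mul0r.
by move=> z; rewrite inE; case: (z == y); rewrite // andbF mul0r eqxx.
Qed.

Lemma conv_munitr x y i a b : (x <= y)%O ->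
  conv i (munit x y) a b = i a x * (b == y)%:R.
Proof.
move=> xy; rewrite (@convE _ _ _ [:: x]) //= ?big_seq1 ?xy ?eqxx //=.
  by case: ifP; rewrite ?mulr1 ?mulr0.
by move=> z; rewrite inE; case: (z == x); rewrite // mulr0 eqxx.
Qed.

Lemma idem_conv_idem x y i :
  conv (conv (e_ x) i) (e_ y) = i x y *: munit x y :> incidence X K.
Proof.
apply: incidence_ext => a b; rewrite conv_idem2 incidenceZE munitE /=.
have [->|] := eqVneq a x; have [->|] := eqVneq b y; rewrite ?andbF ?mul0r ?mulr0 //.
rewrite andbT mul1r; have [_|xy] := boolP (x <= y)%O; first by rewrite mulr1.
by rewrite mulr0 incidence_out.
Qed.

Lemma finc_ext f g : (forall x y, f x y = g x y) -> f = g.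
Proof. by move=> fg; apply/val_inj/incidence_ext. Qed.

Lemma idemM_idem x y f : e_ x * f * e_ y = f x y *: munit x y.
Proof. by apply: val_inj; rewrite /= idem_conv_idem. Qed.

Lemma idemM p q : idem p * idem q = idem (predI p q).
Proof.
apply: finc_ext => x y; rewrite [LHS]conv_diagl /=.
by case: ifP => _; rewrite ?mulr0 // -natrM mulnb.
Qed.

Lemma idemE p x : idem p x x = (p x)%:R.
Proof. by rewrite /= eqxx. Qed.

Lemma idem_id p : idem p * idem p = idem p.
Proof. by rewrite idemM; apply: finc_ext => x y /=; rewrite andbb. Qed.

Lemma finc_diagM f g x : (f * g) x x = f x x * g x x.
Proof. exact: conv_diag. Qed.

(** Local nilpotence of finitary functions: from [y] one may pass to some [z < y]
above [x] with [i z y != 0] only finitely many times. *)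
Lemma finitary_ind i x (Q : X -> Prop) : finitary i ->
    (forall y, (forall z, (x <= z)%O -> (z < y)%O -> i z y != 0 -> Q z) -> Q y) ->
  forall y, (x <= y)%O -> Q y.
Proof.
move=> fi step y0 xy0.
suff h y : (x <= y)%O -> (y <= y0)%O -> Q y by exact: h.
move: y; pose A := fst @` fin_supp i x y0.
apply: (@finite_set_ind _ (fun b a : X => (b < a)%O) A) => [a|b a c||].
- by rewrite ltxx.
- exact: lt_trans.
- exact/finite_image/fi.
move=> y IH xy yy0; apply: step => z xz zy nz.
apply: IH => //; last exact: le_trans (ltW zy) yy0.
by exists (z, y) => //; split=> //=; rewrite ?ltW ?lt_eqF.
Qed.

Lemma idempotent_diag0 f : f * f = f -> (forall x, f x x = 0) -> f = 0.
Proof.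
move=> ff f0; apply: finc_ext => x y; rewrite [RHS]incidence0E.
have [xy|] := boolP (x <= y)%O; last exact: incidence_out.
move: y xy; apply: (finitary_ind (fincP f)) => y IH.
apply/eqP/negPn/negP; rewrite -{1}ff => /conv_neq0[z xz zy].
move/eqP: (xz); apply; apply: IH => //; first exact: incidence_supp xz.
rewrite lt_neqAle (incidence_supp zy) andbT; apply: contraNneq zy => ->.
by rewrite f0.
Qed.

(** The equation [i f = delta] unfolds into chains of nonzero entries of [f]: if
[i a b != 0] with [a < b], then [f] has a nonzero entry off the diagonal in row
[a], and one in column [b], both between [a] and [b]. *)
Lemma finitary_left_inverse f i : (forall x, f x x = 1) ->
  conv i f = delta X K -> finitary i.
Proof.
move=> f1 if1 x y xy.
have key a b : i a b != 0 -> a != b ->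
    [/\ exists2 z, (a < z <= b)%O & f a z != 0
      & exists2 z, (a <= z < b)%O & f z b != 0].
  move=> nz; have := incidence_supp nz => ab; move: b ab nz.
  apply: (finitary_ind (fincP f)) => b IH nz ab.
  have le_ab := incidence_supp nz.
  have [z [nz1 nz2 zb]] : exists z, [/\ i a z != 0, f z b != 0 & z != b].
    apply: contrapT => h; have : conv i f a b = i a b.
      rewrite (@convE _ _ _ [:: b]) ?big_seq1 ?f1 ?mulr1 // => z.
      rewrite mulf_eq0 negb_or inE => /andP[z1 z2]; apply/negPn/negP => zb.
      by apply: h; exists z.
    by rewrite if1 /= (negPf ab) => /eqP; rewrite eq_sym (negPf nz).
  have az := incidence_supp nz1; have {}zb : (z < b)%O.
    by rewrite lt_neqAle zb (incidence_supp nz2).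
  split; last by exists z; rewrite ?az.
  have [eaz|naz] := eqVneq a z.
    by exists b; rewrite ?lexx ?andbT ?lt_neqAle ?ab // eaz.
  have [[w /andP[aw wz] fw] _] := IH z az zb nz2 nz1 naz.
  by exists w => //; rewrite aw (le_trans wz (ltW zb)).
apply: (@sub_finite_set _ _ ((fst @` fin_supp f x y) `*` (snd @` fin_supp f x y))).
  move=> [a b] /= [xa ab yb nab nz].
  have [[z /andP[az zb] fz] [w /andP[aw wb] fw]] := key a b nz nab.
  split; [exists (a, z) => //; split|exists (w, b) => //; split] => //=.
  - exact: ltW.
  - exact: le_trans yb.
  - by rewrite lt_eqF.
  - exact: le_trans aw.
  - exact: ltW.
  - by rewrite lt_eqF.
by apply: finite_setX; apply/finite_image/fincP.
Qed.

End Incidence.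

(** * Automorphisms of the finitary incidence algebra *)

Section FincAutomorphism.
Context {d : Order.disp_t} {X : porderType d} {K : fieldType}.
Implicit Types (x y z a b : X) (f g : finc X K) (p : pred X).
Notation e_ x := (idem (pred1 x) : finc X K).

(** Automorphisms of the [K]-algebra FI(X,K). *)
Definition finc_aut (chi : finc X K -> finc X K) : Prop :=
  @algebra_automorphism K (finc X K) (fun k f => k *: f) chi.

Lemma idem_munit x : e_ x = munit x x.
Proof.
apply: finc_ext => a b; rewrite munitE lexx /=.
case: (eqVneq a b) => [->|ab]; rewrite ?andbb //.
by case: eqVneq => //= <-; rewrite eq_sym (negPf ab).
Qed.

Lemma munit_mul x y z : (x <= y)%O -> (y <= z)%O ->
  munit x z = munit x y * munit y z :> finc X K.
Proof.
move=> xy yz; apply: finc_ext => a b; rewrite [RHS]conv_munitl // !munitE.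
by rewrite (le_trans xy yz) yz eqxx -natrM mulnb.
Qed.

Lemma idem_corner x f : e_ x * f * e_ x = f x x *: e_ x.
Proof. by rewrite idemM_idem -idem_munit. Qed.

Lemma idemMe p x : idem p * e_ x = (p x)%:R *: e_ x.
Proof.
rewrite idemM; apply: finc_ext => a b; rewrite incidenceZE /=.
case: eqP => _; rewrite ?mulr0 //; have [->|] := eqVneq a x; last by rewrite andbF mulr0.
by rewrite andbT mulr1.
Qed.

Section Diagonal.
Variable chi : finc X K -> finc X K.
Hypothesis chi_aut : finc_aut chi.

Lemma aut_idem_id p : chi (idem p) * chi (idem p) = chi (idem p).
Proof. by have [_ <- _ _] := chi_aut; rewrite idem_id. Qed.

(** The diagonal is multiplicative, so the corner [chi (e_ x)] FI [chi (e_ x)],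
which is one-dimensional, can be read off at any [y] with
[chi (e_ x) y y = 1]. *)
Lemma aut_corner x y f : chi (e_ x) y y = 1 ->
  chi (e_ x) * f * chi (e_ x) = f y y *: chi (e_ x).
Proof.
have [_ cM cZ [psi _ psiK]] := chi_aut => xy.
have e : chi (e_ x) * f * chi (e_ x) = psi f x x *: chi (e_ x).
  by rewrite -{1}[f]psiK -!cM idem_corner cZ.
have : (chi (e_ x) * f * chi (e_ x)) y y = psi f x x by rewrite e incidenceZE xy mulr1.
by rewrite !finc_diagM xy mul1r mulr1 => ->.
Qed.

Lemma aut_diag01 p y : chi (idem p) y y = 0 \/ chi (idem p) y y = 1.
Proof.
have := congr1 (fun f : finc X K => f y y) (aut_idem_id p).
rewrite finc_diagM => /eqP; rewrite -subr_eq0 -[X in _ - X]mulr1 -mulrBr mulf_eq0.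
by rewrite subr_eq0 => /orP[]/eqP; [left|right].
Qed.

Lemma aut_diag_ex x : exists y, chi (e_ x) y y = 1.
Proof.
apply: contrapT => h; have /(idempotent_diag0 (aut_idem_id _)) e0 y : chi (e_ x) y y = 0.
  by have [//|y1] := aut_diag01 (pred1 x) y; case: h; exists y.
have := aut_inj chi_aut (etrans e0 (esym (aut0 chi_aut))).
move=> /(congr1 (fun f : finc X K => f x x)); rewrite idemE /= eqxx => /eqP.
by rewrite oner_eq0.
Qed.

Lemma aut_diag_uniq x y z : chi (e_ x) y y = 1 -> chi (e_ x) z z = 1 -> y = z.
Proof.
move=> xy xz; have := congr1 (fun f : finc X K => f z z) (aut_corner (e_ y) xy).
rewrite !finc_diagM incidenceZE !idemE xz /= eqxx !mulr1 mul1r => /eqP.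
by case: (eqVneq z y) => [->|_] //; rewrite eq_sym oner_eq0.
Qed.

Lemma aut_diag_can psi x y : cancel chi psi -> chi (e_ x) y y = 1 ->
  psi (e_ y) x x = 1.
Proof.
move=> chiK xy; have [_ cM _ [psi' _ psi'K]] := chi_aut.
have psiK : cancel psi chi by move=> f; rewrite -[f]psi'K chiK.
have := aut_corner (e_ y) xy; rewrite idemE /= eqxx scale1r -[e_ y]psiK -!cM.
move=> /(can_inj chiK); rewrite idem_corner.
move=> /(congr1 (fun f : finc X K => f x x)).
by rewrite psiK incidenceZE idemE /= eqxx mulr1.
Qed.

(** Since [chi (e_ x) * e_ y * chi (e_ x) = chi (e_ x)], the nonzero element
[chi (munit x x')] factors through its own corner at [(y, y')]. *)
Lemma aut_diag_le x y x' y' : chi (e_ x) y y = 1 -> chi (e_ x') y' y' = 1 ->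
  (x <= x')%O -> (y <= y')%O.
Proof.
move=> xy xy' le_xx'; have [_ cM cZ _] := chi_aut.
apply/negPn/negP => yy'.
have eM : munit x x' = e_ x * munit x x' * e_ x' :> finc X K.
  by rewrite idemM_idem munitE le_xx' !eqxx scale1r.
have corner z z' : chi (e_ z) z' z' = 1 ->
    chi (e_ z) = chi (e_ z) * e_ z' * chi (e_ z).
  by move=> /aut_corner->; rewrite idemE /= eqxx scale1r.
have : chi (munit x x') = chi 0.
  transitivity (chi (e_ x) * (e_ y * chi (munit x x') * e_ y') * chi (e_ x')).
    have -> : chi (munit x x') = chi (e_ x) * chi (munit x x') * chi (e_ x').
      by rewrite -!cM -eM.
    rewrite !mulrA -(corner _ _ xy) -!mulrA; do 2!congr (_ * _).
    by rewrite [RHS]mulrA -(corner _ _ xy').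
  by rewrite idemM_idem incidence_out // scale0r mulr0 mul0r (aut0 chi_aut).
move=> /(aut_inj chi_aut)/(congr1 (fun f : finc X K => f x x')).
by rewrite munitE le_xx' !eqxx => /eqP; rewrite oner_eq0.
Qed.

End Diagonal.

(** An automorphism of FI(X,K) induces an automorphism of the poset [X]. *)
Lemma finc_aut_poset chi : finc_aut chi ->
  exists alpha : poset_aut X, forall x, chi (e_ x) (alpha x) (alpha x) = 1.
Proof.
move=> chi_aut; have [_ _ _ [psi chiK psiK]] := chi_aut.
have psi_aut : finc_aut psi by exact: aut_can chi_aut chiK psiK.
have [h hP] := choice (aut_diag_ex chi_aut).
have [h' h'P] := choice (aut_diag_ex psi_aut).
have hK : cancel h h'.
  by move=> x; apply: (aut_diag_uniq psi_aut (h'P _)); apply: (aut_diag_can chi_aut).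
have h'K : cancel h' h.
  by move=> x; apply: (aut_diag_uniq chi_aut (hP _)); apply: (aut_diag_can psi_aut).
have hmono : {mono h : x y / (x <= y)%O}.
  move=> x y; apply/idP/idP; last exact: (aut_diag_le chi_aut).
  by apply: (aut_diag_le psi_aut); apply: (aut_diag_can chi_aut).
by exists (PosetAut hK h'K hmono).
Qed.

(** ** Simultaneous conjugation of the images of the idempotents *)

Section Straighten.
Variable chi : finc X K -> finc X K.
Hypothesis chi_aut : finc_aut chi.
Hypothesis chi_diag : forall x, chi (e_ x) x x = 1.

Lemma aut_idemMe p x : chi (idem p) * chi (e_ x) = (p x)%:R *: chi (e_ x).
Proof. by have [_ cM cZ _] := chi_aut; rewrite -cM idemMe cZ. Qed.

Lemma aut_idem_diag p x : chi (idem p) x x = (p x)%:R.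
Proof.
have := congr1 (fun f : finc X K => f x x) (aut_idemMe p x).
by rewrite finc_diagM incidenceZE chi_diag !mulr1.
Qed.

Fact straightening_is_incidence : is_incidence (fun a b => chi (e_ b) a b).
Proof. by move=> a b ab; rewrite incidence_out. Qed.

(** The function whose column [b] is the column [b] of [chi (e_ b)]; formally the
sum of all [chi (e_ b) * e_ b]. *)
Definition straightening := mk_incidence straightening_is_incidence.

Fact straightening_inv_is_incidence : is_incidence (fun a b => chi (e_ a) a b).
Proof. by move=> a b ab; rewrite incidence_out. Qed.

(** The function whose row [a] is the row [a] of [chi (e_ a)]; formally the sum of
all [e_ a * chi (e_ a)]. *)
Definition straightening_inv := mk_incidence straightening_inv_is_incidence.

(** If [(a, b)] is in the support with [b] in [S] and [a] not in [S], then
[chi (idem S)] fixes [chi (e_ b)] but is [0] at [(a, a)]; so it is nonzero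
somewhere else in row [a], which can happen for finitely many [a] only. *)
Lemma straightening_separated x y (S : set X) : (x <= y)%O ->
  finite_set [set a | ~ S a /\ exists2 b, S b & fin_supp straightening x y (a, b)].
Proof.
move=> xy; pose g := chi (idem (fun a => `[< S a >])).
apply: (@sub_finite_set _ _ (fst @` fin_supp g x y)); last exact/finite_image/fincP.
move=> a [aS [b bS [/= xa ab yb nab nz]]].
have : (g * chi (e_ b)) a b != 0.
  by rewrite aut_idemMe; case: asboolP => // _; rewrite scale1r.
move=> /conv_neq0[z ga zb]; exists (a, z) => //; split=> //=.
- exact: incidence_supp ga.
- exact: le_trans (incidence_supp zb) yb.
- apply: contraNneq ga => <-; rewrite aut_idem_diag.
  by case: asboolP.
Qed.

(** Choose an entry [(a, v a)] in each nonzero row [a]. A maximal set [S] of rows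
disjoint from [v S] is finite by [straightening_separated] applied to its
complement; any other row [a] has [v a] in [S], which again allows finitely many
[a], or lies in [v S]. *)
Lemma straightening_rows x y : (x <= y)%O ->
  finite_set [set a | exists b, fin_supp straightening x y (a, b)].
Proof.
move=> xy; set U := [set a | _].
pose v a := xget a [set b | fin_supp straightening x y (a, b)].
have vP a : U a -> fin_supp straightening x y (a, v a).
  by move=> /(xgetPex a).
pose indep (S : set X) := S `<=` U /\ forall s t, S s -> S t -> v s != t.
have [S [[SU Sv] Smax]] : exists S, indep S /\ forall B, S `<` B -> ~ indep B.
  apply: Zorn_bigcup => F Findep Ftot; split.
    by move=> a [S FS Sa]; have [SU _] := Findep S FS; apply: SU.
  move=> s t [S FS Ss] [T FT Tt].
  by have [ST|TS] := Ftot _ _ FS FT; [apply: (Findep T FT).2; first exact: ST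
    |apply: (Findep S FS).2; last exact: TS].
(* Each a in S is separated from v a by the complement of S. *)
have Sfin : finite_set S.
  apply: sub_finite_set (straightening_separated (~` S) xy) => a Sa.
  split; first by move=> /(_ Sa).
  exists (v a); last exact/vP/SU.
  by move=> Sva; have := Sv _ _ Sa Sva; rewrite eqxx.
apply: (@sub_finite_set _ _ (S `|`
  [set a | ~ S a /\ exists2 b, S b & fin_supp straightening x y (a, b)] `|` (v @` S))).
  move=> a Ua; have [Sa|Sa] := pselect (S a); first by left; left.
  have [Sva|Sva] := pselect (S (v a)).
    by left; right; split=> //; exists (v a); last exact: vP.
  (* Otherwise a could be added to S. *)
  right; apply: contrapT => nv; apply: (Smax (S `|` [set a])).
    split; [by left|by move=> /(_ a); apply: contra_not Sa; apply; right].
  split; first by move=> b [/SU//|->].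
  move=> s t [Ss|->] [St|->]; first exact: Sv.
  - by apply/eqP => vsa; apply: nv; exists s.
  - by apply/eqP => vat; apply: Sva; rewrite vat.
  - by have [_ _ _ /= ] := vP a Ua; rewrite eq_sym.
rewrite !finite_setU; split; first split=> //; last exact: finite_image.
exact: straightening_separated.
Qed.

Lemma finitary_straightening : finitary straightening.
Proof.
move=> x y xy; set P := fin_supp _ x y.
pose U := [set a | exists b, P (a, b)].
have Ufin : finite_set U by exact: straightening_rows.
(* Descending induction on the row a: there are finitely many rows. *)
have rowfin a : finite_set [set b | P (a, b)].
  apply: (@finite_set_ind _ (fun b a : X => (a < b)%O) U
            (fun a => finite_set [set b | P (a, b)])) => {a} [a|b a c||a IH].
  - exact: ltxx.
  - by move=> ab bc; exact: lt_trans ab.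
  - exact: Ufin.
  pose S := [set b | P (a, b)]; pose g := chi (idem (fun a => `[< S a >])).
  pose Z := [set z | U z /\ (a < z)%O].
  have [nxy|xay] := pselect (~ (x <= a <= y)%O).
    apply: sub_finite_set (finite_set0 X) => b [/= xa ab yb _ _]; apply: nxy.
    by rewrite xa (le_trans ab yb).
  have {xay}/andP[xa ay] : (x <= a <= y)%O by apply: contrapT.
  apply: (@sub_finite_set _ _ ([set z | (z <= y)%O /\ g a z != 0] `|`
     \bigcup_(z in Z) [set b | P (z, b)])).
    move=> b Pab; have [/= _ ab yb nab nz] := Pab.
    have : (g * chi (e_ b)) a b != 0.
      by rewrite aut_idemMe; case: asboolP => // _; rewrite scale1r.
    move=> /conv_neq0[z gaz zb]; have az := incidence_supp gaz.
    have [ezb|nzb] := eqVneq z b; first by subst z; left.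
    have Pzb : P (z, b).
      by split=> //=; [exact: le_trans az|exact: incidence_supp zb].
    (* z = a is impossible, as g a a = 0: a itself is not in S. *)
    right; exists z => //; split; first by exists b.
    rewrite lt_neqAle az andbT; apply: contraNneq gaz => <-; rewrite aut_idem_diag.
    by case: asboolP => // -[_ _ _ /=]; rewrite eqxx.
  rewrite finite_setU; split; first exact: fin_suppl (fincP g) ay.
  apply: bigcup_finite => [|z [Uz az]]; last exact: IH.
  by apply: sub_finite_set Ufin => z [].
apply: (@sub_finite_set _ _ (\bigcup_(a in U) [set (a, b) | b in [set b | P (a, b)]])).
  by move=> [a b] Pab; exists a; [exists b|exists b].
by apply: bigcup_finite => // a _; exact: finite_image.
Qed.

(** The function [straightening] as an element of FI(X,K). *)
Definition straightener := mk_finc finitary_straightening.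

Lemma straighteningVK : conv straightening_inv straightening = delta X K.
Proof.
apply: incidence_ext => a b; transitivity ((chi (e_ a) * chi (e_ b)) a b) => //.
rewrite aut_idemMe incidenceZE /= eq_sym; case: eqVneq => [->|_]; rewrite ?mul0r //.
by rewrite chi_diag mul1r.
Qed.

Lemma finitary_straightening_inv : finitary straightening_inv.
Proof.
apply: (@finitary_left_inverse _ _ _ straightener); first exact: chi_diag.
exact: straighteningVK.
Qed.

(** The inverse of [straightener]. *)
Definition straightenerV := mk_finc finitary_straightening_inv.

Lemma straightenerVK : straightenerV * straightener = 1.
Proof. exact/val_inj/straighteningVK. Qed.

(** [1 - u w] is an idempotent, because [w u = 1], and its diagonal is zero. *)
Lemma straightenerK : straightener * straightenerV = 1.
Proof.
apply/eqP; rewrite -subr_eq0 -opprB oppr_eq0; apply/eqP.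
apply: idempotent_diag0 => [|x].
  rewrite mulrBr mulr1 mulrBl mul1r -mulrA [_ * (_ * straightenerV)]mulrA.
  by rewrite straightenerVK mul1r subrr subr0.
rewrite incidenceDE incidenceNE finc_diagM /= eqxx !chi_diag mulr1; exact: subrr.
Qed.

Lemma straightenerP x : straightenerV * chi (e_ x) * straightener = e_ x.
Proof.
have e : chi (e_ x) * straightener = straightener * e_ x.
  apply: finc_ext => a b; rewrite [RHS]conv_diagr.
  transitivity ((chi (e_ x) * chi (e_ b)) a b) => //.
  by rewrite aut_idemMe incidenceZE mulrC.
by rewrite -mulrA e mulrA straightenerVK mul1r.
Qed.

End Straighten.

(** The entry at [(x, y)] of [chi f] depends on [e_ x * f * e_ y] only, which is a
multiple of the matrix unit; so [sigma x y] is the entry of [chi (munit x y)]. *)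
Lemma finc_aut_multiplicative chi : finc_aut chi ->
  (forall x, chi (e_ x) = e_ x) -> multiplicative_automorphism chi.
Proof.
move=> chi_aut chi_e; have [_ cM cZ _] := chi_aut.
have sinc : is_incidence (fun x y => chi (munit x y) x y).
  by move=> x y xy; rewrite incidence_out.
have chiE f x y : chi f x y = chi (munit x y) x y * f x y.
  have : chi (e_ x * f * e_ y) = e_ x * chi f * e_ y by rewrite !cM !chi_e.
  rewrite !idemM_idem cZ => /(congr1 (fun f : finc X K => f x y)).
  rewrite !incidenceZE munitE.
  have [xy|xy] := boolP (x <= y)%O; last by move=> _; rewrite !incidence_out // mulr0.
  by rewrite !eqxx mulr1 mulrC => <-.
exists (mk_incidence sinc); split => //= [x y xy|x y z /andP[xy yz]].
  apply/eqP => s0; have : chi (munit x y) = chi 0.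
    apply: finc_ext => a b; rewrite (aut0 chi_aut) chiE munitE xy incidence0E.
    have [->|] := eqVneq a x; have [->|] := eqVneq b y; rewrite ?mulr0 //.
    by rewrite s0 mul0r.
  move=> /(aut_inj chi_aut)/(congr1 (fun f : finc X K => f x y)).
  by rewrite munitE xy !eqxx => /eqP; rewrite oner_eq0.
rewrite (munit_mul xy yz).
rewrite cM (@convE _ _ _ [:: y]) ?big_seq1 // => w.
rewrite chiE munitE xy eqxx /= inE; case: (eqVneq w y) => // _.
by rewrite mulr0 mul0r eqxx.
Qed.

End FincAutomorphism.

(** * Automorphisms of D(X,K) *)

Section IdealizationAutomorphism.
Context {d : Order.disp_t} {X : porderType d} {K : fieldType}.
Implicit Types (x y z : X) (f g : finc X K) (i j : incidence X K) (a b : dalg X K).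
Notation e_ x := (idem (pred1 x) : finc X K).

(** Automorphisms of the [K]-algebra D(X,K). *)
Definition dalg_aut (phi : dalg X K -> dalg X K) : Prop :=
  @algebra_automorphism K (dalg X K) (fun k a => k *: a) phi.

Lemma dalg_automorphismP (phi : {rmorphism dalg X K -> dalg X K}) :
  dalg_automorphism phi -> dalg_aut phi.
Proof.
by move=> [phiZ phi_bij]; split=> //; [exact: rmorphD|exact: rmorphM].
Qed.

Lemma dalgM f i g j :
  ((f, i) : dalg X K) * (g, j) = (f * g, conv f j + conv i g) :> dalg X K.
Proof. by []. Qed.

Lemma dalgD f i g j : ((f, i) : dalg X K) + (g, j) = (f + g, i + j) :> dalg X K.
Proof. by []. Qed.

Lemma dalgZ (k : K) f i : k *: ((f, i) : dalg X K) = (k *: f, k *: i) :> dalg X K.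
Proof. by []. Qed.

(** The central square-zero element; its annihilator is [0 + I(X,K)]. *)
Definition eps : dalg X K := (0, delta X K).

Lemma epsM f i : eps * (f, i) = (0, f : incidence X K).
Proof. by rewrite dalgM mul0r conv0l add0r conv1l. Qed.

Lemma Meps f i : ((f, i) : dalg X K) * eps = (0, f : incidence X K).
Proof. by rewrite dalgM mulr0 conv0r addr0 conv1r. Qed.

(** Commuting with the [e_ x] kills the entries off the diagonal; commuting with
the matrix units makes the diagonal constant along comparable elements. *)
Lemma central_incidence i : connected_poset X ->
  (forall f, conv f i = conv i f) -> exists c, i = c *: delta X K.
Proof.
move=> Xconn iC.
have offdiag x y : x != y -> i x y = 0.
  move=> xy; have := congr1 (fun j : incidence X K => j x y) (iC (e_ x)).
  by rewrite conv_diagl conv_diagr /= eqxx eq_sym (negPf xy) mul1r mulr0.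
have diag_le x y : (x <= y)%O -> i x x = i y y.
  move=> xy; have := congr1 (fun j : incidence X K => j x y) (iC (munit x y)).
  by rewrite conv_munitl // conv_munitr // !eqxx mul1r mulr1.
have diag x y : i x x = i y y.
  have [s [xs <-]] := Xconn x y; elim: s x xs => //= z s IH x /andP[xz zs].
  by rewrite -(IH z zs); case/orP: xz => /diag_le.
have [[x0]|X0] := pselect (inhabited X); last first.
  by exists 0; apply: incidence_ext => x; case: X0.
exists (i x0 x0); apply: incidence_ext => x y; rewrite incidenceZE /=.
by case: eqVneq => [->|/offdiag->]; rewrite ?mulr0 // mulr1.
Qed.

Lemma aut_eps phi : connected_poset X -> dalg_aut phi ->
  exists2 k : K, k != 0 & phi eps = k *: eps.
Proof.
move=> Xconn phi_aut; have [_ phiM _ [psi phiK psiK]] := phi_aut.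
(* For X empty all elements are equal. *)
have [[x0]|X0] := pselect (inhabited X); last first.
  exists 1; first exact: oner_neq0.
  by apply: injective_projections; [apply: finc_ext|apply: incidence_ext] => x; case: X0.
have epsC a : phi eps * a = a * phi eps.
  by rewrite -[a]psiK -!phiM; case: (psi a) => f i; rewrite epsM Meps.
case E : (phi eps) => [f i].
have [k fk] : exists c, f = c *: delta X K :> incidence X K.
  apply: central_incidence => // g; have := epsC (g, 0).
  by rewrite E => /(congr1 (fun a : dalg X K => val a.1))/esym.
have [l il] : exists c, i = c *: delta X K.
  apply: central_incidence => // g; have := epsC (g, 0).
  by rewrite E !dalgM conv0r conv0l add0r addr0 => /(congr1 snd)/esym.
(* As eps is square-zero, so is k. *)
have k0 : k = 0.
  have : phi eps * phi eps = 0 by rewrite -phiM /eps epsM; exact: aut0 phi_aut.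
  rewrite E dalgM => ff; have {}ff : f * f = 0 := congr1 fst ff.
  have := congr1 (fun f : finc X K => f x0 x0) ff.
  rewrite finc_diagM fk incidenceZE /= eqxx mulr1 => /eqP.
  by rewrite mulf_eq0 orbb => /eqP.
have El : phi eps = l *: eps.
  rewrite E dalgZ scaler0 -il; congr pair; apply: val_inj.
  by rewrite /= fk k0 scale0r.
exists l; last by rewrite -E.
apply/eqP => l0.
have /(aut_inj phi_aut) : phi eps = phi 0 by rewrite El l0 scale0r (aut0 phi_aut).
move=> /(congr1 (fun a : dalg X K => a.2 x0 x0)) /=.
by rewrite eqxx => /eqP; rewrite oner_eq0.
Qed.

Lemma aut_ideal phi k i : dalg_aut phi -> k != 0 -> phi eps = k *: eps ->
  (phi (0, i)).1 = 0.
Proof.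
move=> phi_aut k0 phie; have [_ phiM _ _] := phi_aut.
have : phi eps * phi (0, i) = 0 by rewrite -phiM epsM; exact: aut0 phi_aut.
case: (phi (0, i)) => g j; rewrite phie -dalg_scalerAl epsM => /(congr1 snd) /= e.
by apply: val_inj; apply: (scalerI k0); rewrite e scaler0.
Qed.

(** The map induced on the quotient FI(X,K) of D(X,K) by [0 + I(X,K)]. *)
Definition finc_part (phi : dalg X K -> dalg X K) f : finc X K := (phi (f, 0)).1.

Lemma finc_partE phi f i : dalg_aut phi -> phi eps = eps ->
  (phi (f, i)).1 = finc_part phi f.
Proof.
move=> phi_aut phie; have [phiD _ _ _] := phi_aut.
have -> : (f, i) = ((f, 0) : dalg X K) + (0, i) :> dalg X K by rewrite dalgD addr0 add0r.
rewrite phiD /= (@aut_ideal _ 1) ?oner_neq0 ?scale1r //; exact: addr0.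
Qed.

Lemma finc_part_aut phi : dalg_aut phi -> phi eps = eps -> finc_aut (finc_part phi).
Proof.
move=> phi_aut phie; have [phiD phiM phiZ [psi phiK psiK]] := phi_aut.
have psi_aut : dalg_aut psi by exact: aut_can phi_aut phiK psiK.
have psie : psi eps = eps by rewrite -phie phiK.
split=> [f g|f g|k f|].
- by rewrite /finc_part -[RHS]/(phi (f, 0) + phi (g, 0)).1 -phiD dalgD addr0.
- rewrite /finc_part -[RHS]/(phi (f, 0) * phi (g, 0)).1 -phiM dalgM.
  by rewrite conv0r conv0l addr0.
- by rewrite /finc_part -[RHS]/(k *: phi (f, 0)).1 -phiZ dalgZ scaler0.
exists (finc_part psi) => f; rewrite {2}/finc_part.
  by rewrite -(finc_partE _ (phi (f, 0)).2) // -surjective_pairing phiK.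
by rewrite -(finc_partE _ (psi (f, 0)).2) // -surjective_pairing psiK.
Qed.

Lemma eps_central a : eps * a = a * eps.
Proof. by case: a => f i; rewrite epsM Meps. Qed.

Lemma dalg_aut_conj phi (a b : dalg X K) : dalg_aut phi -> a * b = 1 -> b * a = 1 ->
  dalg_aut (fun c => a * phi c * b).
Proof.
move=> phi_aut ab ba; apply: (aut_comp (aut_conj _ _ ab ba) phi_aut).
  exact: dalg_scalerAl.
exact: dalg_scalerAr.
Qed.

Lemma conj_eps a b : a * b = 1 -> a * eps * b = eps.
Proof. by move=> ab; rewrite -eps_central -mulrA ab mulr1. Qed.

Lemma dalgM0 f g : ((f, 0) : dalg X K) * (g, 0) = (f * g, 0) :> dalg X K.
Proof. by rewrite dalgM conv0r conv0l addr0. Qed.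

(** The entries of [phi (0, i)] are seen by multiplying with [(e_ x, 0)] on the left
and [(e_ y, 0)] on the right, which reduces the claim to finitary second
components; and [(0, f) = eps * (f, 0)]. *)
Lemma aut_incidence phi : dalg_aut phi -> phi eps = eps ->
  (forall f, finc_part phi f = f) -> forall i, phi (0, i) = (0, i).
Proof.
move=> phi_aut phie phi1 i; have [_ phiM _ _] := phi_aut.
have phiI j : (phi (0, j)).1 = 0.
  by rewrite (@aut_ideal _ 1) ?oner_neq0 ?scale1r.
have phiF (f : finc X K) : phi (0, f : incidence X K) = (0, f : incidence X K).
  rewrite -{1}(epsM f 0) phiM phie [phi _]surjective_pairing epsM.
  by rewrite -/(finc_part phi f) phi1.
have E x y j (a b : dalg X K) : a.1 = e_ x -> b.1 = e_ y -> a * (0, j) * b =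
    (0, (j x y *: munit x y : finc X K) : incidence X K) :> dalg X K.
  case: a b => [f a] [g b] /= -> ->.
  rewrite !dalgM !mulr0 mul0r !conv0r !conv0l !addr0 add0r; congr pair.
  by rewrite idem_conv_idem.
case F : (phi (0, i)) => [g j]; have := phiI i; rewrite F /= => g0; rewrite g0 in F *.
congr pair; apply: incidence_ext => x y.
have [xy|xy] := boolP (x <= y)%O; last by rewrite !incidence_out.
have := congr1 phi (E x y i (e_ x, 0) (e_ y, 0) erefl erefl); rewrite phiF !phiM F.
rewrite (E x y) ?[LHS]phi1 //.
move=> /(congr1 (fun a : dalg X K => a.2 x y)).
by rewrite !incidenceZE munitE xy !eqxx !mulr1.
Qed.

Lemma aut_inner_of_derivations phi : all_derivations_inner X K ->
  dalg_aut phi -> phi eps = eps -> (forall f, finc_part phi f = f) ->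
  inner_automorphism phi.
Proof.
move=> der phi_aut phie phi1; have [phiD phiM phiZ _] := phi_aut.
pose D f := (phi (f, 0)).2.
have phiE f : phi (f, 0) = (f, D f).
  by rewrite {1}[phi _]surjective_pairing; congr pair; exact: phi1.
have Dlin : linear D.
  move=> k f g; rewrite /D -[RHS]/((k *: phi (f, 0) + phi (g, 0)).2) -phiZ -phiD.
  by rewrite dalgZ dalgD scaler0 addr0.
pose Dl := GRing.isLinear.Build K (finc X K) (incidence X K) *:%R D Dlin.
pose DL : {linear finc X K -> incidence X K} := HB.pack D Dl.
have /der[i Di] : derivation DL.
  by move=> f g; rewrite /= {1}/D -dalgM0 phiM !phiE dalgM /= addrC.
exists (1, - i), (1, i); split.
- by rewrite dalgM mulr1 conv1l conv1r subrr.
- by rewrite dalgM mulr1 conv1l conv1r addNr.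
case=> f j; have -> : (f, j) = ((f, 0) : dalg X K) + (0, j) :> dalg X K.
  by rewrite dalgD addr0 add0r.
rewrite phiD phiE (aut_incidence phi_aut phie phi1) !dalgD !addr0 !add0r.
rewrite !dalgM mulr1 mul1r conv1l conv1r -[D f]/(DL f) Di; congr pair.
by rewrite -[- i]scaleN1r convZl scaleN1r addrAC addrA.
Qed.

Lemma aut_inner_of_diagonal phi :
  all_multiplicative_inner X K -> all_derivations_inner X K ->
  dalg_aut phi -> phi eps = eps ->
  (forall x, finc_part phi (e_ x) x x = 1) -> inner_automorphism phi.
Proof.
move=> mult der phi_aut phie phi_diag.
have chi_aut := finc_part_aut phi_aut phie.
pose u := straightener chi_aut phi_diag; pose v := straightenerV chi_aut phi_diag.
have uv : u * v = 1 by exact: straightenerK.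
have vu : v * u = 1 by exact: straightenerVK.
have /mult[s [t [st ts chiE]]] :
    multiplicative_automorphism (fun f => v * finc_part phi f * u).
  apply: finc_aut_multiplicative; last exact: straightenerP.
  apply: (aut_comp (aut_conj _ _ vu uv) chi_aut).
    exact: finc_scalerAl.
  exact: finc_scalerAr.
pose a : dalg X K := (u * s, 0); pose b : dalg X K := (t * v, 0).
have ab : a * b = 1 by rewrite dalgM0 -mulrA [s * _]mulrA st mul1r uv.
have ba : b * a = 1 by rewrite dalgM0 -mulrA [v * _]mulrA vu mul1r ts.
have psi_aut := dalg_aut_conj phi_aut ba ab.
have psie : b * phi eps * a = eps by rewrite phie conj_eps.
have [|c [c' [cc' c'c psiE]]] := aut_inner_of_derivations der psi_aut psie.
  move=> f; rewrite /finc_part /= -/(finc_part phi f).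
  have -> g : t * v * g * (u * s) = t * (v * g * u) * s by rewrite !mulrA.
  by rewrite chiE !mulrA ts mul1r -mulrA ts mulr1.
exists (a * c), (c' * b); split.
- by rewrite -mulrA [c * _]mulrA cc' mul1r.
- by rewrite -mulrA [b * _]mulrA ba mul1r.
move=> e; have := psiE e; rewrite /= => /(congr1 (fun w => a * w * b)).
by rewrite !mulrA ab mul1r -[_ * a * b]mulrA ab mulr1.
Qed.

Lemma tilde_scale_aut k : k != 0 -> dalg_aut (tilde_scale k).
Proof.
move=> k0; split.
- by move=> [f i] [g j]; rewrite /tilde_scale /= scalerDr.
- by move=> [f i] [g j]; congr pair; rewrite /= convZl convZr scalerDr.
- by move=> l [f i]; congr pair; rewrite /= !scalerA mulrC.
exists (tilde_scale k^-1) => -[f i]; rewrite /tilde_scale /=.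
  by rewrite scalerA mulVf // scale1r.
by rewrite scalerA divff // scale1r.
Qed.

Lemma tilde_conv (alpha : poset_aut X) i j : finitary i \/ finitary j ->
  tilde_incidence alpha (conv i j) =
  conv (tilde_incidence alpha i) (tilde_incidence alpha j).
Proof.
move=> fij; apply: incidence_ext => x y.
have /finite_uniq_seq[s us sP] : finite_set
    [set z | i (aut_inv alpha x) z * j z (aut_inv alpha y) != 0].
  by case: fij => [/conv_fin_suppl|/conv_fin_suppr]; apply.
rewrite -[LHS]/(conv i j (aut_inv alpha x) (aut_inv alpha y)) (convE us sP).
rewrite (@convE _ _ _ (map alpha s)).
- by rewrite big_map; apply: eq_bigr => z _ /=; rewrite !aut_funK.
- by rewrite map_inj_uniq //; exact: can_inj (aut_funK alpha).
by move=> z /sP zs; rewrite -[z](aut_invK alpha); exact: map_f.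
Qed.

(** The inverse of a poset automorphism. *)
Definition poset_aut_inv (alpha : poset_aut X) : poset_aut X :=
  PosetAut (aut_invK alpha) (aut_funK alpha) (aut_inv_mono alpha).

Lemma tilde_autK (alpha : poset_aut X) :
  cancel (@tilde_aut _ _ K alpha) (tilde_aut (poset_aut_inv alpha)).
Proof.
move=> [f i]; congr pair; [apply: finc_ext|apply: incidence_ext] => x y /=;
by rewrite !aut_funK.
Qed.

Lemma tilde_autVK (alpha : poset_aut X) :
  cancel (@tilde_aut _ _ K (poset_aut_inv alpha)) (tilde_aut alpha).
Proof.
move=> [f i]; congr pair; [apply: finc_ext|apply: incidence_ext] => x y /=;
by rewrite !aut_invK.
Qed.

Lemma tilde_aut_aut (alpha : poset_aut X) : dalg_aut (tilde_aut alpha).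
Proof.
split.
- by move=> [f i] [g j]; congr pair; [apply: finc_ext|apply: incidence_ext].
- move=> [f i] [g j]; rewrite /tilde_aut !dalgM; congr pair.
    by apply: val_inj; rewrite /= tilde_conv //; left; exact: fincP.
  rewrite -(tilde_conv alpha (or_introl (fincP f))).
  rewrite -(tilde_conv alpha (or_intror (fincP g))).
  exact: incidence_ext.
- by move=> k [f i]; congr pair; [apply: finc_ext|apply: incidence_ext].
exists (tilde_aut (poset_aut_inv alpha)); [exact: tilde_autK|exact: tilde_autVK].
Qed.

Lemma tilde_eps (alpha : poset_aut X) : tilde_aut alpha eps = eps.
Proof.
congr pair; [apply: finc_ext|apply: incidence_ext] => x y //=.
by rewrite (can_eq (aut_invK alpha)).
Qed.

Lemma tilde_idem (alpha : poset_aut X) x : tilde_finc alpha (e_ x) = e_ (alpha x).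
Proof.
apply: finc_ext => y z /=.
by rewrite (can_eq (aut_invK alpha)) (can2_eq (aut_invK alpha) (aut_funK alpha)).
Qed.

Theorem dalg_aut_decomposition phi : connected_poset X ->
  all_multiplicative_inner X K -> all_derivations_inner X K -> dalg_aut phi ->
  exists (Psi : dalg X K -> dalg X K) (alpha : poset_aut X) (k : K),
    [/\ inner_automorphism Psi, k != 0 &
        phi =1 Psi \o tilde_aut alpha \o tilde_scale k].
Proof.
move=> Xconn mult der phi_aut; have [k k0 phie] := aut_eps Xconn phi_aut.
have phi1_aut : dalg_aut (phi \o tilde_scale k^-1).
  by apply: (aut_comp phi_aut); apply: tilde_scale_aut; rewrite invr_eq0.
have phi1e : phi (tilde_scale k^-1 eps) = eps.
  have -> : tilde_scale k^-1 eps = k^-1 *: eps by rewrite dalgZ scaler0.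
  by have [_ _ -> _] := phi_aut; rewrite phie scalerA mulVf // scale1r.
have [alpha alphaP] := finc_aut_poset (finc_part_aut phi1_aut phi1e).
pose Psi := phi \o tilde_scale k^-1 \o tilde_aut (poset_aut_inv alpha).
exists Psi, alpha, k; split=> //.
  apply: aut_inner_of_diagonal => //.
  - exact: aut_comp phi1_aut (tilde_aut_aut _).
  - by rewrite /Psi /= tilde_eps.
  move=> x; have := alphaP (aut_inv alpha x); rewrite aut_invK.
  rewrite -[aut_inv alpha x]/(poset_aut_inv alpha x) -tilde_idem.
  rewrite /finc_part /Psi /= /tilde_aut /tilde_scale /=.
  have -> // : tilde_incidence (poset_aut_inv alpha) 0 = 0 :> incidence X K.
  exact: incidence_ext.
move=> [f i]; rewrite /Psi /= tilde_autK; congr phi.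
by rewrite /tilde_scale /= scalerA mulVf // scale1r.
Qed.

End IdealizationAutomorphism.

(** * Posets with an element comparable with all elements *)

Section ComparableElement.
Context {d : Order.disp_t} {X : porderType d} {K : fieldType}.
Implicit Types (x y z : X) (f g : finc X K) (i j : incidence X K).
Notation e_ x := (idem (pred1 x) : finc X K).
Variable x0 : X.
Hypothesis x0P : forall y, (x0 >=< y)%O.

Lemma comparable_multiplicative_inner : all_multiplicative_inner X K.
Proof.
move=> phi [s [s0 sM phiE]].
pose h x := if (x0 <= x)%O then s x0 x else (s x x0)^-1.
have h0 x : h x != 0.
  rewrite /h; have := x0P x; rewrite /Order.comparable.
  by case: ifP => /= [/s0//|_ /s0]; rewrite invr_eq0.
have hM x y : (x <= y)%O -> h x * s x y = h y.
  move=> xy; rewrite /h; have [x0x|x0x] := boolP (x0 <= x)%O.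
    by rewrite (le_trans x0x xy) sM ?x0x.
  have xx0 : (x <= x0)%O by have := x0P x; rewrite /Order.comparable (negPf x0x).
  have [x0y|x0y] := boolP (x0 <= y)%O.
    by rewrite -(sM x x0 y) ?xx0 // mulKf ?s0.
  have yx0 : (y <= x0)%O by have := x0P y; rewrite /Order.comparable (negPf x0y).
  rewrite -(sM x y x0) ?xy // invfM mulrAC.
  by rewrite mulVf ?mul1r // s0.
exists (diag_finc (fun x => (h x)^-1)), (diag_finc h); split.
- apply: finc_ext => x y; rewrite [LHS]conv_diagl /=.
  by case: eqP => _; rewrite ?mulr0 // mulVf.
- apply: finc_ext => x y; rewrite [LHS]conv_diagl /=.
  by case: eqP => _; rewrite ?mulr0 // divff.
move=> f; apply: finc_ext => x y.
rewrite phiE [RHS]conv_diagr conv_diagl.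
have [xy|xy] := boolP (x <= y)%O; last by rewrite !incidence_out // !(mulr0, mul0r).
by rewrite -(hM _ _ xy) mulrAC -!mulrA mulKf // mulrC.
Qed.

Lemma convNl i j : conv (- i) j = - conv i j.
Proof. by rewrite -scaleN1r convZl scaleN1r. Qed.

Lemma convNr i j : conv i (- j) = - conv i j.
Proof. by rewrite -scaleN1r convZr scaleN1r. Qed.

(** The map [f |-> f i - i f] is a derivation. *)
Lemma ad_derivation i f g : conv (f * g) i - conv i (f * g) =
  conv (conv f i - conv i f) g + conv f (conv g i - conv i g).
Proof.
rewrite (convDl_finr _ _ (fincP g)) (convDr_finl _ _ (fincP f)) convNl convNr.
rewrite (convA12 i (fincP f) (fincP g)) (convA13 i (fincP f) (fincP g)).
by rewrite (convA23 i (fincP f) (fincP g)) [RHS]addrC addrA addrNK.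
Qed.

Lemma comparable_derivations_inner : all_derivations_inner X K.
Proof.
move=> D Dder.
have Di x y z : D (e_ x) y z = D (e_ x) y z * (z == x)%:R + (y == x)%:R * D (e_ x) y z.
  by rewrite -{1}(idem_id (pred1 x)) Dder incidenceDE conv_diagl conv_diagr.
have De x : D (e_ x) x x = 0.
  have := Di x x x; rewrite eqxx mul1r mulr1 => /eqP.
  by rewrite addrC -subr_eq0 opprD addNKr oppr_eq0 => /eqP.
have Dxy x y : x != y -> D (e_ x) x y = - D (e_ y) x y.
  move=> xy; have e0 : e_ x * e_ y = 0.
    by rewrite idemMe /= eq_sym (negPf xy) scale0r.
  have := congr1 (fun i : incidence X K => i x y) (Dder (e_ x) (e_ y)).
  rewrite e0 linear0 incidenceDE conv_diagr conv_diagl /= !eqxx mul1r mulr1.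
  by move/eqP; rewrite eq_sym addr_eq0 => /eqP.
have iinc : is_incidence (fun x y => D (e_ x) x y).
  by move=> x y xy; rewrite incidence_out.
(* D and f |-> f i - i f agree at all e_x, so D' vanishes there. *)
pose i := mk_incidence iinc.
pose D' f := D f - (conv f i - conv i f).
have D'M f g : D' (f * g) = conv (D' f) g + conv f (D' g).
  rewrite /D' Dder ad_derivation (convDl_finr (D f) _ (fincP g)).
  rewrite (convDr_finl (D g) _ (fincP f)) convNl convNr opprD; exact: addrACA.
have D'e x : D' (e_ x) = 0.
  apply: incidence_ext => y z.
  rewrite !(incidenceDE, incidenceNE) conv_diagl conv_diagr Di /=.
  have [->|yx] := eqVneq y x; have [->|zx] := eqVneq z x.
  - by rewrite De !mulr0 !mul0r subrr addr0 subr0.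
  - by rewrite !mulr0 add0r subr0 subrr.
  - by rewrite !mul0r !mulr1 addr0 add0r opprK Dxy // subrr.
  - by rewrite !mulr0 !mul0r subrr addr0 subr0.
pose t x y := D' (munit x y) x y.
have D'E f x y : D' f x y = t x y * f x y.
  transitivity (D' (e_ x * f * e_ y) x y).
    rewrite !D'M !D'e conv0l conv0r addr0 add0r.
    by rewrite conv_idem2 /= !eqxx mul1r.
  have D'Z k g : D' (k *: g) = k *: D' g.
    by rewrite /D' linearZ !scalerBr -convZl -convZr.
  by rewrite idemM_idem D'Z incidenceZE mulrC.
have DE f x y : D f x y = (conv f i - conv i f) x y + t x y * f x y.
  by rewrite -D'E /D' incidenceDE addrC incidenceNE subrK.
have tM x y z : (x <= y)%O -> (y <= z)%O -> t x y + t y z = t x z.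
  move=> xy yz; have eM : munit x z = munit x y * munit y z :> finc X K.
    exact: munit_mul.
  by rewrite {3}/t eM D'M incidenceDE conv_munitl // conv_munitr // !eqxx mul1r mulr1.
pose h x := if (x0 <= x)%O then t x0 x else - t x x0.
have hM x y : (x <= y)%O -> t x y = h y - h x.
  move=> xy; rewrite /h; have [x0x|x0x] := boolP (x0 <= x)%O.
    by rewrite (le_trans x0x xy) -(tM x0 x y) // addrAC subrr add0r.
  have xx0 : (x <= x0)%O by have := x0P x; rewrite /Order.comparable (negPf x0x).
  have [x0y|x0y] := boolP (x0 <= y)%O.
    by rewrite -(tM x x0 y) // opprK addrC.
  have yx0 : (y <= x0)%O by have := x0P y; rewrite /Order.comparable (negPf x0y).
  by rewrite -(tM x y x0) // opprK addrC addrK.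
exists (i + diag_finc h) => f; apply: incidence_ext => x y; rewrite DE.
rewrite (convDr_finl _ _ (fincP f)) (convDl_finr _ _ (fincP f)).
rewrite !(incidenceDE, incidenceNE) conv_diagl conv_diagr.
have [xy|xy] := boolP (x <= y)%O.
  by rewrite hM // mulrBl opprD addrACA [h y * _]mulrC.
by rewrite !incidence_out // !mulr0 mul0r subrr addr0 subrr.
Qed.

End ComparableElement.

Theorem proposition4p2 (d : Order.disp_t) (X : porderType d) (K : fieldType)
    (hconn : connected_poset X) :
  (all_multiplicative_inner X K -> all_derivations_inner X K ->
   forall phi : {rmorphism dalg X K -> dalg X K}, dalg_automorphism phi ->
   exists (Psi : dalg X K -> dalg X K) (alpha : poset_aut X) (k : K),
     [/\ inner_automorphism Psi, k != 0 &
         phi =1 Psi \o tilde_aut alpha \o tilde_scale k]) /\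
  ((exists x : X, forall y : X, (x >=< y)%O) ->
   all_multiplicative_inner X K /\ all_derivations_inner X K).
Proof.
split=> [mult der phi /dalg_automorphismP|[x0 x0P]].
  exact: dalg_aut_decomposition.
split; first exact: comparable_multiplicative_inner x0P.
exact: comparable_derivations_inner x0P.
Qed.
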